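(* Let $n\ge 2$ and let $L$ be an $n$-Lie superalgebra over a field $\mathbb{F}$ of characteristic zero with $\dim L=(m|k)$. Then $$\dim \mathcal{M}(L)\leq \sum_{i=0}^{n}\binom{m}{i}\,\mathcal{L}(n-i,k),$$ where $\mathcal{L}(0,k)=1$ and $\mathcal{L}(t,k)=\sum_{j=1}^{t}\binom{t-1}{j-1}\binom{k}{j}$ for $1\le t\le n$. Moreover, equality occurs if and only if $L$ is abelian.
   Context: Fix a field $\mathbb{F}$ of characteristic zero and an integer $n\ge 2$. A superspace is a $\mathbb{Z}_2$-graded vector space $V=V_0\oplus V_1$; elements of $V_a$ ($a\in\mathbb{Z}_2$) are homogeneous of degree $|v|=a$. A sub-superspace is a subspace $U$ with $U=(U\cap V_0)\oplus(U\cap V_1)$. An $n$-Lie superalgebra is a superspace $L=L_0\oplus L_1$ with an $n$-linear bracket $[-,\ldots,-]:L^{\times n}\to L$ such that for homogeneous elements: (i) $|[x_1,\ldots,x_n]|=\sum_i|x_i|$ mod 2; (ii) $[x_1,\ldots,x_i,x_{i+1},\ldots,x_n]=-(-1)^{|x_i||x_{i+1}|}[x_1,\ldots,x_{i+1},x_i,\ldots,x_n]$; (iii) $[x_1,\ldots,x_{n-1},[y_1,\ldots,y_n]]=[[x_1,\ldots,x_{n-1},y_1],y_2,\ldots,y_n]+\sum_{i=2}^{n}(-1)^{(\sum_{j=1}^{i-1}|y_j|)(|x_1|+\cdots+|x_{n-1}|)}[y_1,\ldots,y_{i-1},[x_1,\ldots,x_{n-1},y_i],y_{i+1},\ldots,y_n]$.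 A graded ideal is a sub-superspace $I$ with $[I,L,\ldots,L]\subseteq I$. $L^2=[L,\ldots,L]$ is the span of all brackets $[x_1,\ldots,x_n]$; $L$ is abelian if $L^2=0$. Homomorphisms are degree-preserving linear maps respecting brackets. The Schur multiplier of $L$ is $\mathcal{M}(L)=\dfrac{R\cap F^2}{[R,F,\ldots,F]}$, where $0\to R\to F\to L\to 0$ is a free presentation of $L$ (a short exact sequence with $F$ a free $n$-Lie superalgebra); up to isomorphism it is independent of the free presentation. $\dim L=(m|k)$ means $\dim L_0=m$ and $\dim L_1=k$ (both finite); in inequalities, $\dim$ denotes total dimension. *)

(* Defs.v *)
From HB Require Import structures.
From mathcomp Require Import all_boot all_order perm all_algebra.
From mathcomp Require Import boolp classical_sets.

Set Implicit Arguments.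
Unset Strict Implicit.
Unset Printing Implicit Defensive.

Import GRing.Theory.
Import Quotient.

Local Open Scope quotient_scope.
Local Open Scope classical_set_scope.
Local Open Scope ring_scope.

Section LinearAlgebra.
Variables (K : fieldType) (V : lmodType K).

Definition subspace (A : set V) : Prop :=
  A 0 /\ forall (a : K) (u v : V), A u -> A v -> A (a *: u + v).

Definition span (A : set V) : set V := smallest subspace A.

(* The subspace A has a basis with d elements. *)
Definition has_dim (A : set V) (d : nat) : Prop :=
  exists e : 'I_d -> V,
    (forall c : 'I_d -> K, \sum_i c i *: e i = 0 -> forall i, c i = 0) /\
    span (range e) = A.

Lemma subspace_span (A : set V) : subspace (span A).
Proof.
split=> [B [[B0 _] _]|a u v su sv B [sB AB]] //.
by apply: sB.2; [apply: su|apply: sv].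
Qed.

Definition in_span (A : set V) : {pred V} := fun v => `[< span A v >].

Lemma in_span_submod_closed (A : set V) : submod_closed (in_span A).
Proof.
have [s0 sl] := subspace_span A.
split=> [|a u v /asboolP su /asboolP sv]; apply/asboolP => //.
exact: sl.
Qed.

HB.instance Definition _ (A : set V) :=
  GRing.isSubmodClosed.Build K V (in_span A) (in_span_submod_closed A).

End LinearAlgebra.

(* The quotient space V / span A; it extends the quotient Z-module of
   ring_quotient with the scaling. *)
Section QuotientSpace.
Variables (K : fieldType) (V : lmodType K) (A : set V).

Definition lquot := Quotient.quot (in_span A).
HB.instance Definition _ := GRing.Zmodule.on lquot.

Definition lquot_pi (v : V) : lquot := \pi_(Quotient.quot (in_span A)) v.

Lemma lquot_piE u v : (lquot_pi u = lquot_pi v) <-> span A (u - v).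
Proof.
split=> [/eqP|suv]; first by rewrite -idealrBE => /asboolP.
by apply/eqP; rewrite -idealrBE; apply/asboolP.
Qed.

Lemma lquot_piD u v : lquot_pi (u + v) = lquot_pi u + lquot_pi v.
Proof. exact: pi_add. Qed.

Lemma lquot_reprK (x : lquot) :
  lquot_pi (repr (x : Quotient.quot (in_span A))) = x.
Proof. exact: reprK. Qed.

Definition lquot_scale (a : K) (x : lquot) : lquot :=
  lquot_pi (a *: repr (x : Quotient.quot (in_span A))).

Lemma lquot_piZ a v : lquot_pi (a *: v) = lquot_scale a (lquot_pi v).
Proof.
apply/lquot_piE; rewrite -scalerBr.
have [s0 sl] := subspace_span A.
rewrite -[_ *: _]addr0; apply: sl => //.
by apply/lquot_piE; rewrite lquot_reprK.
Qed.

Lemma lquot_scalerA a b x :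
  lquot_scale a (lquot_scale b x) = lquot_scale (a * b) x.
Proof. by rewrite -[x]lquot_reprK -!lquot_piZ scalerA. Qed.

Lemma lquot_scale1r : left_id 1 lquot_scale.
Proof. by move=> x; rewrite -[x]lquot_reprK -lquot_piZ scale1r. Qed.

Lemma lquot_scalerDr : right_distributive lquot_scale +%R.
Proof.
move=> a x y; rewrite -[x]lquot_reprK -[y]lquot_reprK.
by rewrite -lquot_piD -!lquot_piZ -lquot_piD scalerDr.
Qed.

Lemma lquot_scalerDl x : {morph lquot_scale^~ x : a b / a + b}.
Proof.
by move=> a b; rewrite -[x]lquot_reprK -!lquot_piZ -lquot_piD scalerDl.
Qed.

HB.instance Definition _ := GRing.Zmodule_isLmodule.Build K lquot
  lquot_scalerA lquot_scale1r lquot_scalerDr lquot_scalerDl.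

Lemma lquot_pi_is_linear : linear lquot_pi.
Proof. by move=> a u v; rewrite lquot_piD lquot_piZ. Qed.

HB.instance Definition _ :=
  GRing.isLinear.Build K V lquot _ lquot_pi lquot_pi_is_linear.

End QuotientSpace.

(* Z/2 is represented by bool with addition (+). *)
Record superspace (K : fieldType) := Superspace {
  ss_sort :> lmodType K;
  hpart : bool -> set ss_sort;
  hpart_subspace : forall a, subspace (hpart a);
  hpart_sum : forall v : ss_sort,
    exists v0 v1, [/\ hpart false v0, hpart true v1 & v = v0 + v1];
  hpart_cap : hpart false `&` hpart true = [set 0]
}.
Arguments hpart {K} V a : rename.

Definition upd (n : nat) (T : Type) (x : 'I_n -> T) (i : 'I_n) (u : T) :
  'I_n -> T := fun j => if j == i then u else x j.

Definition parity (n : nat) (P : pred 'I_n) (p : 'I_n -> bool) : bool :=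
  \big[addb/false]_(i | P i) p i.

(* The entries of an n-fold bracket are numbered from 0 to n - 1. In the
   identity [bracket_filippov], l is the last index, so that
   [bracket (upd x l z)] is [x_1, ..., x_(n-1), z] and the entry x l is
   irrelevant. *)
Record nLieSuperalgebra (n : nat) (K : fieldType) := NLieSuperalgebra {
  nls_space :> superspace K;
  bracket : ('I_n -> nls_space) -> nls_space;
  bracket_linear : forall (x : 'I_n -> nls_space) (i : 'I_n) (a : K)
      (u v : nls_space),
    bracket (upd x i (a *: u + v)) =
    a *: bracket (upd x i u) + bracket (upd x i v);
  bracket_hpart : forall (x : 'I_n -> nls_space) (p : 'I_n -> bool),
    (forall i, hpart nls_space (p i) (x i)) ->
    hpart nls_space (parity xpredT p) (bracket x);
  bracket_skew : forall (x : 'I_n -> nls_space) (p : 'I_n -> bool)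
      (i j : 'I_n),
    (forall r, hpart nls_space (p r) (x r)) ->
    j = i.+1 :> nat ->
    bracket x =
    - ((-1) ^+ (p i && p j) *: bracket (fun r => x (tperm i j r)));
  bracket_filippov : forall (l : 'I_n) (x y : 'I_n -> nls_space)
      (p q : 'I_n -> bool),
    l.+1 = n ->
    (forall i, i != l -> hpart nls_space (p i) (x i)) ->
    (forall i, hpart nls_space (q i) (y i)) ->
    bracket (upd x l (bracket y)) =
    \sum_(i < n)
      (-1) ^+ (parity [pred j : 'I_n | (j < i)%N] q && parity (predC1 l) p) *:
      bracket (upd y i (bracket (upd x l (y i))))
}.
Arguments bracket {n K} L x : rename.

Section NLieSuperalgebras.
Variables (n : nat) (K : fieldType).
Implicit Types F G L : nLieSuperalgebra n K.

(* L^2 = [L, ..., L] *)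
Definition derived L : set L := span (range (bracket L)).
Arguments derived : clear implicits.

Definition abelian_nls L : Prop := derived L = [set 0].

(* [I, L, ..., L], with the first entry in I *)
Definition bracket_ideal L (I : set L) : set L :=
  span (bracket L @` [set x | forall i : 'I_n, i = 0%N :> nat -> I (x i)]).

Definition nls_hom F L (phi : {linear F -> L}) : Prop :=
  (forall a u, hpart F a u -> hpart L a (phi u)) /\
  (forall x : 'I_n -> F, phi (bracket F x) = bracket L (fun i => phi (x i))).

(* F is free on some Z/2-graded set (X, deg), embedded by iota. *)
Definition free_nls F : Prop :=
  exists (X : Type) (deg : X -> bool) (iota : X -> F),
    (forall t, hpart F (deg t) (iota t)) /\
    forall G (f : X -> G), (forall t, hpart G (deg t) (f t)) ->
      exists phi : {linear F -> G},
        [/\ nls_hom phi, forall t, phi (iota t) = f t &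
            forall psi : {linear F -> G}, nls_hom psi ->
              (forall t, psi (iota t) = f t) -> psi =1 phi].

Definition kernel F L (phi : {linear F -> L}) : set F := [set u | phi u = 0].

(* 0 -> kernel phi -> F -> L -> 0 *)
Definition free_presentation F L (phi : {linear F -> L}) : Prop :=
  [/\ free_nls F, nls_hom phi & range phi = setT].

(* (R `&` F^2) / [R, F, ..., F] as a subspace of F / [R, F, ..., F], where
   R is the kernel of phi; [bracket_ideal] is already a span, so the span
   taken in [lquot] does not change it. *)
Definition schur_multiplier F L (phi : {linear F -> L}) :
    set (lquot (bracket_ideal (kernel phi))) :=
  lquot_pi (bracket_ideal (kernel phi)) @` (kernel phi `&` derived F).

End NLieSuperalgebras.
Arguments derived {n K} L.
Arguments schur_multiplier {n K F L} phi.

Definition calL (t k : nat) : nat :=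
  if t is 0 then 1%N
  else (\sum_(1 <= j < t.+1) 'C(t.-1, j.-1) * 'C(k, j))%N.

(* Main.v *)
Require Import Defs.
From HB Require Import structures.
From mathcomp Require Import all_boot all_order all_algebra.
From mathcomp Require Import perm zify.
From mathcomp Require Import boolp classical_sets.

(* Write N for the sum in the theorem: it is the dimension of the n-th super
   exterior power of L, with basis the sorted n-tuples of homogeneous basis
   indices in which even indices do not repeat. Lift a homogeneous basis of L to
   F. Modulo [R, F, ..., F] a bracket depends only on the classes modulo R of its
   entries, so F^2 / [R, F, ..., F] is spanned by the N brackets of lifts along
   sorted tuples, and the multiplier is a subspace of it. If L is not abelian,
   some bracket of F lies outside R, the subspace is proper and the inequality
   strict. If L is abelian, the subspace is everything, and the N brackets are
   independent there: freeness of F lifts phi to the central extension of L by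
   its n-th super exterior power with bracket (0, x_1 ^ ... ^ x_n), where their
   images are the standard basis. *)

Set Implicit Arguments.
Unset Strict Implicit.
Unset Printing Implicit Defensive.

Import GRing.Theory.
Local Open Scope ring_scope.

(* mathcomp.algebra.vector shadows the span of Defs. *)
Local Notation span := Defs.span.

(** * Spans, free families and dimensions *)

Section Subspaces.
Variables (K : fieldType) (V : lmodType K).
Implicit Types (A B : set V) (u v : V).

Lemma subspaceD A u v : subspace A -> A u -> A v -> A (u + v).
Proof. by move=> [_ Al] Au Av; rewrite -[u]scale1r; apply: Al. Qed.

Lemma subspaceZ A (a : K) u : subspace A -> A u -> A (a *: u).
Proof. by move=> [A0 Al] Au; rewrite -[_ *: _]addr0; apply: Al. Qed.

Lemma subspaceB A u v : subspace A -> A u -> A v -> A (u - v).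
Proof.
by move=> sA Au Av; apply: subspaceD => //; rewrite -scaleN1r; apply: subspaceZ.
Qed.

Lemma subspace_sum A (I : finType) (F : I -> V) :
  subspace A -> (forall i, A (F i)) -> A (\sum_i F i).
Proof.
move=> sA AF; apply: (big_ind A) => //; first by case: sA.
by move=> u v; apply: subspaceD.
Qed.

Lemma subspace_capP A B : subspace A -> subspace B -> subspace (A `&` B)%classic.
Proof.
move=> [A0 Al] [B0 Bl]; split=> // a u v [Au Bu] [Av Bv].
by split; [apply: Al | apply: Bl].
Qed.

Lemma sub_span A : (A `<=` span A)%classic.
Proof. by move=> u Au B [_ AB]; apply: AB. Qed.

Lemma span_min A B : subspace B -> (A `<=` B)%classic -> (span A `<=` B)%classic.
Proof. by move=> sB AB u; apply. Qed.

Lemma span_id A : subspace A -> span A = A.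
Proof.
by move=> sA; apply/seteqP; split; [apply: span_min | apply: sub_span].
Qed.

Lemma span_rangeP (I : finType) (e : I -> V) v :
  span (range e) v <-> exists c : I -> K, v = \sum_i c i *: e i.
Proof.
split=> [|[c ->]]; last first.
  apply: (subspace_sum (subspace_span _)) => i.
  by apply: (subspaceZ _ (subspace_span _)); apply: sub_span; exists i.
apply: (@span_min _ [set v | exists c : I -> K, v = \sum_i c i *: e i]).
  split=> [|a x y [c ->] [d ->]].
    by exists (fun=> 0); rewrite big1 // => i _; rewrite scale0r.
  exists (fun i => a * c i + d i); rewrite scaler_sumr -big_split.
  by apply: eq_bigr => i _; rewrite scalerDl scalerA.
move=> _ [i _ <-]; exists (fun j => (j == i)%:R).
rewrite (bigD1 i) //= eqxx scale1r big1 ?addr0 // => j /negPf ->.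
exact: scale0r.
Qed.

Definition free_family (I : finType) (e : I -> V) :=
  forall c : I -> K, \sum_i c i *: e i = 0 -> forall i, c i = 0.

(** A nonzero row in the left kernel of the coefficient matrix of [e] over [w] would be a linear
    relation among the [e i]; so the matrix has rank [d], at most its number of columns. *)
Lemma free_family_le d N (e : 'I_d -> V) (w : 'I_N -> V) :
  free_family e -> (forall i, span (range w) (e i)) -> (d <= N)%N.
Proof.
move=> fe sw.
have /choice [c ec] : forall i, exists c : 'I_N -> K, e i = \sum_j c j *: w j.
  by move=> i; apply/span_rangeP.
pose M : 'M[K]_(d, N) := \matrix_(i, j) c i j.
have [|kerM] := boolP (row_free M).
  by move/eqP <-; apply: rank_leq_col.
have /negP [] : nz_row (kermx M) != 0 by rewrite nz_row_eq0 kermx_eq0.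
apply/eqP/rowP => i; rewrite [RHS]mxE.
move: i; apply: fe.
have /sub_kermxP /rowP kM := nz_row_sub (kermx M).
under eq_bigr => i _ do rewrite ec scaler_sumr.
rewrite exchange_big big1 //= => j _.
under eq_bigr => i _ do rewrite scalerA.
rewrite -scaler_suml; have := kM j; rewrite !mxE.
by under eq_bigr => i _ do rewrite mxE; move=> ->; rewrite scale0r.
Qed.

Definition extend d (e : 'I_d -> V) v : 'I_d.+1 -> V :=
  fun i => if unlift ord_max i is Some j then e j else v.

Lemma sum_extend d (e : 'I_d -> V) v (c : 'I_d.+1 -> K) :
  \sum_i c i *: extend e v i =
  \sum_i c (lift ord_max i) *: e i + c ord_max *: v.
Proof.
rewrite big_ord_recr /= /extend unlift_none; congr (_ + _).
apply: eq_bigr => i _.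
suff -> : widen_ord (leqnSn d) i = lift ord_max i by rewrite liftK.
by apply: val_inj; rewrite /= /bump leqNgt ltn_ord.
Qed.

Lemma free_extend d (e : 'I_d -> V) v :
  free_family e -> ~ span (range e) v -> free_family (extend e v).
Proof.
move=> fe nv c; rewrite sum_extend => sum0.
have [cm0|cm0] := eqVneq (c ord_max) 0.
  move: sum0; rewrite cm0 scale0r addr0 => /fe c0 i.
  case: (unliftP ord_max i) => [j ->|-> //].
  exact: c0.
case: nv.
have -> : v = - (c ord_max)^-1 *:
    \sum_i c (lift ord_max i) *: e i.
  move/eqP: sum0; rewrite addr_eq0 => /eqP ->.
  by rewrite scalerN scaleNr opprK scalerA mulVf // scale1r.
apply: (subspaceZ _ (subspace_span _)).
by apply/span_rangeP; exists (fun i => c (lift ord_max i)).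
Qed.

(** A free family in [A] of maximal size is a basis, since [extend] would enlarge a non-spanning
    one; [free_family_le] bounds the sizes by [N]. *)
Lemma subspace_has_dim N (w : 'I_N -> V) A :
  subspace A -> (A `<=` span (range w))%classic ->
  exists2 d, has_dim A d & (d <= N)%N.
Proof.
move=> sA Aw.
pose P d := `[< exists e : 'I_d -> V, free_family e /\ forall i, A (e i) >].
have exP : exists d, P d.
  by exists 0%N; apply/asboolP; exists (fun=> 0); split=> [c _|] [].
have leP d : P d -> (d <= N)%N.
  by move=> /asboolP [e [fe Ae]]; apply: (free_family_le fe) => i; apply: Aw.
case: (ex_maxnP exP leP) => d /asboolP [e [fe Ae]] dmax.
exists d; last by apply: leP; apply/asboolP; exists e.
exists e; split=> //; apply/seteqP; split=> [|v Av].
  by apply: span_min => // _ [i _ <-].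
apply: contrapT => nv.
have /dmax : P d.+1; last by rewrite ltnn.
apply/asboolP; exists (extend e v); split; first exact: free_extend.
by move=> i; rewrite /extend; case: unlift.
Qed.

(** A basis of [A] extended by [v] is a free family of size [d.+1] in the span of [w]. *)
Lemma has_dim_lt N (w : 'I_N -> V) A d v :
  (A `<=` span (range w))%classic -> has_dim A d ->
  span (range w) v -> ~ A v -> (d < N)%N.
Proof.
move=> Aw [e [fe eA]] wv nAv; rewrite -eA in nAv.
apply: (free_family_le (w := w) (free_extend fe nAv)) => i.
rewrite /extend; case: unlift => [j|//].
by apply: Aw; rewrite -eA; apply: sub_span; exists j.
Qed.

Lemma has_dim_ge N (w : 'I_N -> V) A d :
  has_dim A d -> free_family w -> (forall i, A (w i)) -> (N <= d)%N.
Proof.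
by move=> [e [_ eA]] fw Aw; apply: (free_family_le (w := e) fw) => i; rewrite eA.
Qed.

End Subspaces.

Lemma subspace_image (K : fieldType) (U V : lmodType K) (f : {linear U -> V})
  (A : set U) : subspace A -> subspace (f @` A)%classic.
Proof.
move=> [A0 Al]; split=> [|a _ _ [u Au <-] [v Av <-]].
  by exists 0; rewrite ?linear0.
by exists (a *: u + v); rewrite ?linearP //; apply: Al.
Qed.

Lemma subspace_preimage (K : fieldType) (U V : lmodType K)
  (f : {linear U -> V}) (A : set V) : subspace A -> subspace (f @^-1` A)%classic.
Proof.
move=> [A0 Al]; split=> [|a u v Au Av] /=; first by rewrite linear0.
by rewrite linearP; apply: Al.
Qed.

Lemma subspace0 (K : fieldType) (V : lmodType K) : subspace [set (0 : V)].
Proof. by split=> // a u v /= -> ->; rewrite scaler0 addr0. Qed.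

(** * Multilinear maps on spanning sets *)

Section Multilinear.
Variables (K : fieldType) (n : nat) (V U : lmodType K).
Implicit Types (f : ('I_n -> V) -> U) (S : set U) (x : 'I_n -> V).

Definition multilinear f := forall x i (a : K) u v,
  f (upd x i (a *: u + v)) = a *: f (upd x i u) + f (upd x i v).

Lemma upd_id x i : upd x i (x i) = x.
Proof. by apply: funext => j; rewrite /upd; case: eqP => // ->. Qed.

(* The slots are released one at a time: once those below k may be arbitrary,
   the values allowed in slot k form a subspace. *)
Lemma multilinear_span f S (A : 'I_n -> set V) :
  multilinear f -> subspace S ->
  (forall x, (forall i, A i (x i)) -> S (f x)) ->
  forall x, (forall i, span (A i) (x i)) -> S (f x).
Proof.
move=> fl sS fA x xA.
suff slots k : (k <= n)%N -> forall y,
    (forall i : 'I_n, (i < k)%N -> span (A i) (y i)) ->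
    (forall i : 'I_n, (k <= i)%N -> A i (y i)) -> S (f y).
  by apply: (slots n) => // i; rewrite leqNgt ltn_ord.
elim: k => [|k IHk] kn y ylt yge; first by apply: fA => i; apply: yge.
pose ik := Ordinal kn.
rewrite -(upd_id y ik).
apply: (@span_min _ _ (A ik) [set u | S (f (upd y ik u))]); last exact: ylt.
  split=> [|a u v Su Sv] /=; last by rewrite fl; apply: (proj2 sS).
  have /= := fl y ik (-1) 0 0; rewrite scaler0 addr0 scaleN1r addNr => ->.
  by case: sS.
move=> u Au /=; apply: IHk => [|i ik'|i ik']; first exact: ltnW.
  rewrite /upd; case: eqP => [iE|_]; first by rewrite iE ltnn in ik'.
  by apply: ylt; apply: ltnW.
rewrite /upd; case: eqP => [->//|/eqP ne]; apply: yge.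
by rewrite ltn_neqAle ik' andbT eq_sym.
Qed.

End Multilinear.

(** * Homogeneous components and degree-preserving maps *)

Section Superspaces.
Variables (K : fieldType).
Implicit Types V W : superspace K.

Lemma hpart_zero V (u : V) a b : hpart V a u -> hpart V b u -> a != b -> u = 0.
Proof.
suff h w : hpart V false w -> hpart V true w -> w = 0.
  by case: a b => [] [] // ? ? _; apply: h.
by move=> w0 w1; have : [set (0 : V)]%classic w by rewrite -(hpart_cap V).
Qed.

Lemma hpart_parts V (v : V) : exists w : bool -> V,
  (forall a, hpart V a (w a)) /\ v = w false + w true.
Proof.
have [v0 [v1 [h0 h1 ->]]] := hpart_sum v.
by exists (fun a => if a then v1 else v0); split=> // -[].
Qed.

(** The difference of the even parts is also odd, hence zero; likewise for the odd parts. *)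
Lemma hpart_parts_uniq V (w w' : bool -> V) :
  (forall a, hpart V a (w a)) -> (forall a, hpart V a (w' a)) ->
  w false + w true = w' false + w' true -> w =1 w'.
Proof.
move=> hw hw' e.
have e' : w false - w' false = w' true - w true.
  by apply/eqP; rewrite subr_eq addrAC (addrC (w' true)) -e addrK.
have d0 : w false - w' false = 0.
  apply: (@hpart_zero V _ false true) => //; last rewrite e'.
    exact: (subspaceB (hpart_subspace _ _)).
  exact: (subspaceB (hpart_subspace _ _)).
move=> [].
  by apply/esym/eqP; rewrite -subr_eq0 -e' d0.
by apply/eqP; rewrite -subr_eq0 d0.
Qed.

Definition even_linear V W (f : V -> W) :=
  forall a u, hpart V a u -> hpart W a (f u).

(** The component of degree [a] of any preimage works, by uniqueness of components in [W]. *)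
Lemma even_linear_lift V W (f : {linear V -> W}) a w :
  even_linear f -> range f = setT -> hpart W a w ->
  exists2 v, hpart V a v & f v = w.
Proof.
move=> fe fs hw.
have [v _ fv] : range f w by rewrite fs.
have [u [hu vE]] := hpart_parts v.
exists (u a) => //.
have e := @hpart_parts_uniq W (fun b => f (u b)) (fun b => if b == a then w else 0).
apply: etrans (e _ _ _ a) _ => [b|b||]; last by rewrite eqxx.
- exact: fe.
- case: eqP => [->//|_]; exact: (hpart_subspace _ b).1.
by rewrite -linearD -vE fv; case: a {hw e} => /=; rewrite ?addr0 ?add0r.
Qed.

(** Both components of [u] are again killed by [f]: the kernel is a graded subspace. *)
Lemma kernel_homogeneous V W (f : {linear V -> W}) u :
  even_linear f -> f u = 0 ->
  span [set v | f v = 0 /\ exists a, hpart V a v] u.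
Proof.
move=> fe fu; have [w [hw uE]] := hpart_parts u.
have e := @hpart_parts_uniq W (fun b => f (w b)) (fun=> 0).
have fw b : f (w b) = 0.
  apply: (e _ _ _ b) => [a|a|]; first exact: fe.
    exact: (hpart_subspace _ _).1.
  by rewrite -linearD -uE fu addr0.
rewrite uE; apply: (subspaceD (subspace_span _)); apply: sub_span.
  by split=> //; exists false.
by split=> //; exists true.
Qed.

End Superspaces.

(** * Homogeneous bases with their coordinates *)

Section Basis.
Variables (K : fieldType) (V : superspace K) (D : nat) (par : pred 'I_D).

(** Linear independence of [e] is encoded by the coordinates: it follows from [gb_linear] and
    [gb_dual]. *)
Record graded_basis (e : 'I_D -> V) (c : 'I_D -> V -> K) : Prop := GradedBasis {
  gb_hpart : forall j, hpart V (par j) (e j);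
  gb_linear : forall j a u v, c j (a *: u + v) = a * c j u + c j v;
  gb_expand : forall v, v = \sum_j c j v *: e j;
  gb_dual : forall i j, c i (e j) = (i == j)%:R;
  gb_coord0 : forall a v j, hpart V a v -> par j != a -> c j v = 0
}.

End Basis.

Lemma exists_graded_basis (K : fieldType) (V : superspace K) m k :
  has_dim (hpart V false) m -> has_dim (hpart V true) k ->
  exists (e : 'I_(m + k) -> V) (c : 'I_(m + k) -> V -> K),
    graded_basis (fun j => (m <= j)%N) e c.
Proof.
move=> [e0 [f0 s0]] [e1 [f1 s1]].
pose e j := match split j with inl i => e0 i | inr i => e1 i end.
have eE (c : 'I_(m + k) -> K) : \sum_j c j *: e j =
    \sum_i c (lshift k i) *: e0 i + \sum_i c (rshift m i) *: e1 i.
  rewrite big_split_ord /= /e; congr (_ + _); apply: eq_bigr => i _.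
    by rewrite (unsplitK (inl i)).
  by rewrite (unsplitK (inr i)).
have h0 (c : 'I_m -> K) : hpart V false (\sum_i c i *: e0 i).
  by rewrite -s0; apply/span_rangeP; exists c.
have h1 (c : 'I_k -> K) : hpart V true (\sum_i c i *: e1 i).
  by rewrite -s1; apply/span_rangeP; exists c.
have fe : free_family e.
  move=> c; rewrite eE => sum0.
  set w0 := \sum_i _ in sum0; set w1 := \sum_i _ in sum0.
  have e01 := @hpart_parts_uniq K V (fun a => if a then w1 else w0) (fun=> 0).
  have w00 a : (if a then w1 else w0) = 0.
    apply: (e01 _ _ _ a) => [[]|b|]; first exact: h1; first exact: h0.
      exact: (hpart_subspace _ _).1.
    by rewrite addr0.
  move=> j; rewrite -(splitK j); case: (split j) => i /=.
    exact: (f0 (fun i => c (lshift k i)) (w00 false)).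
  exact: (f1 (fun i => c (rshift m i)) (w00 true)).
have ee v : exists c : 'I_(m + k) -> K, v = \sum_j c j *: e j.
  have [w [hw ->]] := hpart_parts v.
  have /span_rangeP [c0 ->] : span (range e0) (w false) by rewrite s0.
  have /span_rangeP [c1 ->] : span (range e1) (w true) by rewrite s1.
  exists (fun j => match split j with inl i => c0 i | inr i => c1 i end).
  rewrite eE; congr (_ + _); apply: eq_bigr => i _.
    by rewrite (unsplitK (inl i)).
  by rewrite (unsplitK (inr i)).
have /choice [c cE] := ee.
(* Coordinates are unique, so each remaining field reduces to exhibiting an expansion. *)
have cuniq v (b : 'I_(m + k) -> K) : v = \sum_j b j *: e j -> c v =1 b.
  move=> vE j; apply/eqP; rewrite -subr_eq0; apply/eqP.
  apply: (fe (fun j => c v j - b j)).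
  under eq_bigr => i _ do rewrite scalerBl.
  by rewrite sumrB -vE -cE subrr.
have eh (j : 'I_(m + k)) : hpart V (m <= j)%N (e j).
  rewrite -{1}(splitK j) /e; case: (split j) => i /=.
    by rewrite leqNgt ltn_ord -s0; apply: sub_span; exists i.
  by rewrite leq_addr -s1; apply: sub_span; exists i.
exists e, (fun j v => c v j); split=> //.
- move=> j a u v; apply: (cuniq _ (fun j => a * c u j + c v j)).
  rewrite {1}(cE u) {1}(cE v) scaler_sumr -big_split.
  by apply: eq_bigr => i _; rewrite scalerDl scalerA.
- move=> i j; apply: (cuniq _ (fun i => (i == j)%:R)).
  rewrite (bigD1 j) //= eqxx scale1r big1 ?addr0 // => i' /negPf ->.
  exact: scale0r.
move=> a v j hv ja.
case: a hv ja => hv ja.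
  have /span_rangeP [b vE] : span (range e1) v by rewrite s1.
  rewrite (cuniq v (fun j => match split j with inl i => 0 | inr i => b i end)).
    by case: splitP ja => // i ->; rewrite leq_addr.
  rewrite eE vE [X in _ = X + _]big1 => [|i _]; last by rewrite (unsplitK (inl i)) scale0r.
  by rewrite add0r; apply: eq_bigr => i _; rewrite (unsplitK (inr i)).
have /span_rangeP [b vE] : span (range e0) v by rewrite s0.
rewrite (cuniq v (fun j => match split j with inl i => b i | inr i => 0 end)).
  by case: splitP ja => // i ->; rewrite leqNgt ltn_ord.
rewrite eE vE [X in _ = _ + X]big1 => [|i _]; last by rewrite (unsplitK (inr i)) scale0r.
by rewrite addr0; apply: eq_bigr => i _; rewrite (unsplitK (inl i)).
Qed.

(** * Super-sorted tuples and bubble sort *)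

Section SortedTuples.
Variables (D : nat) (par : pred 'I_D).

(* The superle-sorted tuples are the nondecreasing ones in which even indices
   do not repeat: they index a basis of the super exterior power. *)
Definition superle (u v : 'I_D) := (u < v)%N || (u == v) && par u.

Lemma superle_trans : transitive superle.
Proof.
move=> v u w; rewrite /superle => /orP [uv|/andP [/eqP -> pv]] //.
by move=> /orP [vw|/andP [/eqP <- pw]]; rewrite ?uv // (ltn_trans uv vw).
Qed.

Lemma superle_leq : subrel superle (fun u v => u <= v)%N.
Proof. by move=> u v /orP [/ltnW|/andP [/eqP ->]]. Qed.

Lemma perm_superle_sorted (s t : seq 'I_D) :
  sorted superle s -> sorted superle t -> perm_eq s t -> s = t.
Proof.
move=> ss st; apply: (@sorted_eq _ (fun u v : 'I_D => u <= v)%N).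
- by move=> v u w; apply: leq_trans.
- by move=> u v uv; apply/val_inj/anti_leq.
- exact: (sub_sorted superle_leq).
- exact: (sub_sorted superle_leq).
Qed.

Section Tuples.
Variable n : nat.
Implicit Types (t s : n.-tuple 'I_D) (i j : 'I_n).

Definition swap t i j : n.-tuple 'I_D := [tuple tnth t (tperm i j r) | r < n].

Lemma perm_eq_swap t i j : perm_eq (swap t i j) t.
Proof. by apply/tuple_permP; exists (tperm i j). Qed.

Lemma swapK t i j : swap (swap t i j) i j = t.
Proof. by apply: eq_from_tnth => r; rewrite !tnth_mktuple tpermK. Qed.

Lemma tnth_sorted t :
  (forall i j, j = i.+1 :> nat -> superle (tnth t i) (tnth t j)) ->
  sorted superle t.
Proof.
case: n t => [|n'] t h; first by rewrite [t]tuple0.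
have x0 : 'I_D := tnth t ord0.
apply/(sortedP x0) => i; rewrite size_tuple => lt_i.
have := h (Ordinal (ltnW lt_i)) (Ordinal lt_i) erefl.
by rewrite !(tnth_nth x0).
Qed.

Lemma sorted_tnth t i j :
  sorted superle t -> (i < j)%N -> superle (tnth t i) (tnth t j).
Proof.
have x0 : 'I_D := tnth t i.
move=> st ij; rewrite !(tnth_nth x0).
by apply: (sorted_ltn_nth superle_trans) => //; rewrite inE size_tuple.
Qed.

(** A termination measure: earlier slots weigh more, so exchanging an adjacent inversion lowers the
    weight by exactly the difference of its two entries. *)
Definition weight t := (\sum_(r < n) (n - r) * tnth t r)%N.

Lemma weight_swap t i j : j = i.+1 :> nat -> (tnth t j < tnth t i)%N ->
  (weight (swap t i j) < weight t)%N.
Proof.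
move=> ji tji; have ij : i != j by apply/eqP => /(congr1 val) /=; lia.
have sumE (F : 'I_n -> nat) :
    (\sum_r F r = F i + (F j + \sum_(r | (r != i) && (r != j)) F r))%N.
  by rewrite (bigD1 i) //= (bigD1 j) // eq_sym.
rewrite /weight !sumE.
rewrite !tnth_mktuple tpermL tpermR.
under eq_bigr => r /andP [ri rj] do rewrite tnth_mktuple tpermD 1?eq_sym //.
set w := (\sum_(r < n | _) _)%N; have := ltn_ord j; nia.
Qed.

(* Bubble sort: an adjacent swap that removes an inversion lowers the weight. *)
Lemma bubble_ind (P : n.-tuple 'I_D -> Prop) :
  (forall t, sorted superle t -> P t) ->
  (forall t i j, j = i.+1 :> nat -> P (swap t i j) -> P t) ->
  (forall t i j, j = i.+1 :> nat -> tnth t i = tnth t j -> ~~ par (tnth t i) ->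
     P t) ->
  forall t, P t.
Proof.
move=> Psort Pswap Prep t.
have [w] := ubnP (weight t); elim: w t => // w IHw t tw.
have [/Psort //|nst] := boolP (sorted superle t).
have [|/existsNP [i /existsNP [j /not_implyP [ji /negP]]]] :=
    EM (forall i j, j = i.+1 :> nat -> superle (tnth t i) (tnth t j)).
  by move/tnth_sorted; rewrite (negPf nst).
(* The adjacent pair that fails [superle] is either a repeated even index or a strict inversion. *)
rewrite negb_or -leqNgt leq_eqVlt.
case/andP=> /orP [/eqP /val_inj e|lt_ji].
  by rewrite e eqxx => np; apply: (Prep t i j) => //; rewrite e.
move=> _; apply: (Pswap t i j) => //; apply: IHw.
by rewrite ltnS in tw; apply: leq_trans tw; apply: weight_swap.
Qed.

End Tuples.
End SortedTuples.

(** * Counting sorted tuples *)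

Section Counting.

(** The number of multisets of size [t] in [k] elements. For positive [t] this is Vandermonde's
    identity, whose [j = 0] term vanishes. *)
Lemma calLE t k : calL t k = 'C((t + k).-1, t).
Proof.
case: t => [|t]; first by rewrite bin0.
rewrite addSn /= /calL addnC -binomial.Vandermonde big_ord_recl subn0.
rewrite [X in _ = (_ * X + _)%N]bin_small // muln0 add0n big_add1 big_mkord.
by apply: eq_bigr => i _; rewrite mulnC /= subSS bin_sub // -ltnS.
Qed.

Lemma card_weakly_sorted t k :
  #|[set u : t.-tuple 'I_k | sorted leq (map val u)]| = calL t k.
Proof.
rewrite calLE; case: k => [|k]; last by rewrite addnS card_sorted_tuples.
(* Here [k = 0]: there is one tuple when [t = 0] and none otherwise. *)
case: t => [|t].
  rewrite (eq_card (B := predT)) ?card_tuple // => u.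
  by rewrite !inE tuple0.
by rewrite addn0 /= bin_small // eq_card0 // => u; case: (thead u).
Qed.

Variables m k : nat.

Definition odd_index : pred 'I_(m + k) := fun j => (m <= j)%N.
Notation sle := (superle odd_index).

Definition even_part (t : seq 'I_(m + k)) : seq 'I_m :=
  pmap (fun j => if split j is inl i then Some i else None) t.
Definition odd_part (t : seq 'I_(m + k)) : seq 'I_k :=
  pmap (fun j => if split j is inr i then Some i else None) t.

Notation join u v := ([seq lshift k i | i <- u] ++ [seq rshift m i | i <- v]).

Lemma even_part_join u v : even_part (join u v) = u.
Proof.
rewrite /even_part pmap_cat.
elim: u => [|i u IHu] /=; first by elim: v => //= i v; rewrite (unsplitK (inr i)).
by rewrite (unsplitK (inl i)) /= IHu.
Qed.

Lemma odd_part_join u v : odd_part (join u v) = v.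
Proof.
rewrite /odd_part pmap_cat.
elim: u => [|i u IHu] /=; last by rewrite (unsplitK (inl i)).
by elim: v => //= i v IHv; rewrite (unsplitK (inr i)) /= IHv.
Qed.

(** Every even index lies below every odd one, so only comparisons within [u] and within [v] matter;
    there [superle] is [<] and [<=] respectively. *)
Lemma sorted_join u v :
  sorted sle (join u v) = sorted ltn (map val u) && sorted leq (map val v).
Proof.
rewrite (sorted_pairwise (@superle_trans _ _)) pairwise_cat.
rewrite (sorted_pairwise ltn_trans) (sorted_pairwise leq_trans) !pairwise_map.
rewrite (_ : allrel _ _ _) /=; last first.
  apply/allrelP => _ _ /mapP [i _ ->] /mapP [j _ ->].
  by rewrite /superle /= (leq_trans (ltn_ord i)) ?leq_addr.
congr (_ && _); apply: eq_pairwise => i j /=.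
  by rewrite /superle /odd_index /= (leqNgt m) ltn_ord andbF orbF.
by rewrite /superle /odd_index /= (leq_addr _ m) andbT ltn_add2l
  (inj_eq (@rshift_inj _ _)) orbC [RHS]leq_eqVlt.
Qed.

Lemma join_parts t : sorted sle t -> join (even_part t) (odd_part t) = t.
Proof.
elim: t => //= j t IHt pt; have := IHt (path_sorted pt).
have := order_path_min (@superle_trans _ _) pt.
rewrite -{1 4}(splitK j) /even_part /odd_part /=; case: (split j) => i /=.
  by move=> _ ->.
(* The head is odd and the later entries are no smaller, so none of them is even. *)
move=> /allP jt; suff e0 : even_part t = [::].
  by rewrite -/(even_part t) -/(odd_part t) e0 /= => ->.
apply/eqP; rewrite -size_eq0 size_pmap -leqn0 leqNgt -has_count.
apply/negP => /hasP [j' /jt]; case: splitP => // i' j'i' /superle_leq /=.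
by rewrite j'i'; have := ltn_ord i'; lia.
Qed.

(** Group the tuples by their number [i] of even entries: each is a strictly increasing [i]-tuple in
    ['I_m] followed by a weakly increasing [(n - i)]-tuple in ['I_k]. *)
Lemma card_superle_sorted n :
  #|[set t : n.-tuple 'I_(m + k) | sorted sle t]| =
  (\sum_(0 <= i < n.+1) 'C(m, i) * calL (n - i) k)%N.
Proof.
rewrite big_mkord -sum1_card.
have size_even t : (size (even_part (t : n.-tuple 'I_(m + k))) < n.+1)%N.
  by rewrite size_pmap ltnS -{2}(size_tuple t) count_size.
rewrite (partition_big (fun t => Ordinal (size_even t)) predT) //=.
apply: eq_bigr => i _; have le_in : (i <= n)%N by rewrite -ltnS.
rewrite -(card_ltn_sorted_tuples i m) -card_weakly_sorted -cardsX sum1_card.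
pose f (uv : i.-tuple 'I_m * (n - i).-tuple 'I_k) : n.-tuple 'I_(m + k) :=
  tcast (subnKC le_in) [tuple of join uv.1 uv.2].
have fE uv : f uv = join uv.1 uv.2 :> seq _ by rewrite val_tcast.
rewrite -(card_imset _ (_ : injective f)); last first.
  move=> [u v] [u' v'] /(congr1 val); rewrite /= !fE /= => e.
  by congr pair; apply: val_inj;
    [rewrite /= -(even_part_join u v) e even_part_join
    |rewrite /= -(odd_part_join u v) e odd_part_join].
apply: eq_card => t; rewrite [LHS]unfold_in /= inE; apply/andP/imsetP.
  move=> [st /eqP /(congr1 val) /= sz].
  have sz' : size (odd_part t) == (n - i)%N.
    have := congr1 size (join_parts st); rewrite size_cat !size_map sz size_tuple.
    by move=> e; apply/eqP/(@addnI i); rewrite e subnKC.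
  exists (Tuple (introT eqP sz), Tuple sz'); last first.
    by apply: val_inj; rewrite /= fE /= join_parts.
  by rewrite inE /= !inE -sorted_join join_parts.
move=> [[u v]]; rewrite inE /= !inE => suv ->.
by split; [rewrite fE sorted_join | apply/eqP/val_inj; rewrite /= fE even_part_join size_tuple].
Qed.

End Counting.

(** * The super exterior power and the central extension built on it *)

Section Wedge.
Variables (K : fieldType) (V : superspace K) (D : nat) (par : pred 'I_D).
Variables (e : 'I_D -> V) (c : 'I_D -> V -> K).
Hypothesis ec : graded_basis par e c.
Variable n : nat.
Implicit Types (x : 'I_n -> V) (t s : n.-tuple 'I_D).
Notation sle := (superle par).

(** The factor of graded skew-symmetry for adjacent entries of degrees [a] and [b]. *)
Definition kappa (a b : bool) : K := - (-1) ^+ (a && b).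

Lemma kappaC a b : kappa a b = kappa b a.
Proof. by rewrite /kappa andbC. Qed.

Lemma kappa_sqr a b : kappa a b * kappa a b = 1.
Proof. by rewrite /kappa mulrNN -signr_addb addbb. Qed.

(* The sign of exchanging u and v when they are out of order; a repeated even
   index gives 0. *)
Definition pair_sign (u v : 'I_D) : K :=
  if (u < v)%N then 1 else if u == v then (par u)%:R else kappa (par u) (par v).

(** On the diagonal, [kappa] is -1 at an even index, where [pair_sign] is 0, and 1 at an odd
    index. *)
Lemma pair_signC u v : pair_sign u v = kappa (par u) (par v) * pair_sign v u.
Proof.
rewrite /pair_sign (eq_sym v); case: ltngtP => [uv|vu|/val_inj ->].
- have /negPf -> : u != v by apply: contraTneq uv => ->; rewrite ltnn.
  by rewrite (kappaC (par v)) kappa_sqr.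
- have /negPf -> : u != v by apply: contraTneq vu => ->; rewrite ltnn.
  by rewrite mulr1.
by rewrite eqxx /kappa andbb; case: (par v); rewrite ?mulr0 // opprK mul1r.
Qed.

Definition tuple_sign t : K :=
  \prod_(ab : 'I_n * 'I_n | (ab.1 < ab.2)%N) pair_sign (tnth t ab.1) (tnth t ab.2).

Lemma tuple_sign_sorted t : sorted sle t -> tuple_sign t = 1.
Proof.
move=> st; rewrite /tuple_sign big1 // => -[a b] /= ab.
have := sorted_tnth st ab; rewrite /pair_sign /superle.
by case: ltnP => //= _ /andP [-> ->].
Qed.

(** Because [i] and [j] are adjacent, their transposition permutes the other pairs of increasing
    slots; only the factor at [(i, j)] changes. *)
Lemma tuple_sign_swap t (i j : 'I_n) : j = i.+1 :> nat ->
  tuple_sign t = kappa (par (tnth t i)) (par (tnth t j)) * tuple_sign (swap t i j).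
Proof.
move=> ji; have lt_ij : (i < j)%N by rewrite ji.
rewrite /tuple_sign (bigD1 (i, j)) //= [in RHS](bigD1 (i, j)) //=.
rewrite !tnth_mktuple tpermL tpermR mulrA -pair_signC; congr (_ * _).
have tpermS : injective (fun ab : 'I_n * 'I_n => (tperm i j ab.1, tperm i j ab.2)).
  by move=> [a b] [a' b'] /= [/perm_inj -> /perm_inj ->].
rewrite (reindex_inj tpermS) /=; apply: eq_big => [[a b]|[a b] _] /=.
  rewrite !xpair_eqE.
  case: (tpermP i j a) => [->|->|/eqP + /eqP +];
  case: (tpermP i j b) => [->|->|/eqP + /eqP +];
  rewrite -!val_eqE /=; lia.
by rewrite !tnth_mktuple.
Qed.

(* The monomial of t is tuple_sign t times that of its sorted rearrangement, so
   the coordinate at a sorted s collects the t with the same entries as s. *)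
Definition wedge x : {ffun n.-tuple 'I_D -> K^o} :=
  [ffun s : n.-tuple 'I_D =>
     \sum_(t : n.-tuple 'I_D | perm_eq t s)
       tuple_sign t * \prod_i c (tnth t i) (x i)].

Lemma coord0 j : c j 0 = 0.
Proof. by have := gb_linear ec j (-1) 0 0; rewrite scaler0 addr0 mulN1r addNr. Qed.

Lemma wedge_multilinear : multilinear wedge.
Proof.
move=> x i a u v; apply/ffunP => s; rewrite !ffunE /= scaler_sumr -big_split.
apply: eq_bigr => t _ /=.
have updE w : \prod_r c (tnth t r) (upd x i w r) =
    c (tnth t i) w * \prod_(r | r != i) c (tnth t r) (x r).
  rewrite (bigD1 i) //= /upd eqxx; congr (_ * _).
  by apply: eq_bigr => r /negPf ->.
rewrite !updE (gb_linear ec) -[_ *: _]/(_ * _).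
by rewrite mulrDl mulrDr -mulrA (mulrCA _ a).
Qed.

Lemma wedge_eq0 x i : x i = 0 -> wedge x = 0.
Proof.
move=> xi0; apply/ffunP => s; rewrite !ffunE big1 // => t _.
by rewrite (bigD1 i) //= xi0 coord0 mul0r mulr0.
Qed.

Definition seq_parity (s : seq 'I_D) := \big[addb/false]_(u <- s) par u.

(** A coordinate vanishes on vectors of the other degree, so only index tuples with the degrees of
    [x] contribute to [wedge x]. *)
Lemma homogeneous_prod x p t : (forall i, hpart V (p i) (x i)) ->
  \prod_i c (tnth t i) (x i) != 0 -> forall i, par (tnth t i) = p i.
Proof.
move=> xp nz i; apply/eqP; apply: contra_neqT nz => ti.
by rewrite (bigD1 i) //= (gb_coord0 ec (xp i) ti) mul0r.
Qed.

Lemma wedge_parity x p s : (forall i, hpart V (p i) (x i)) ->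
  wedge x s != 0 -> seq_parity s = parity xpredT p.
Proof.
move=> xp; apply: contra_neq_eq => sp; rewrite ffunE big1 // => t ts.
apply/eqP; apply: contraR sp; rewrite mulf_eq0 negb_or => /andP [_ nz].
have tp := homogeneous_prod xp nz.
rewrite /seq_parity -(perm_big _ ts) big_tuple /parity.
by apply/eqP; apply: eq_bigr.
Qed.

(** Reindexing the sum by [swap] leaves the coordinate products unchanged; where they are nonzero,
    the index degrees are those of [x], and [tuple_sign_swap] gives the factor. *)
Lemma wedge_skew x p (i j : 'I_n) : (forall r, hpart V (p r) (x r)) ->
  j = i.+1 :> nat ->
  wedge x = kappa (p i) (p j) *: wedge (fun r => x (tperm i j r)).
Proof.
move=> xp ji; apply/ffunP => s; rewrite !ffunE /= -[_ *: _]/(_ * _) mulr_sumr.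
rewrite [RHS](reindex_inj (h := fun t => swap t i j)) /=; last first.
  by move=> t t' /(congr1 (fun t => swap t i j)); rewrite !swapK.
apply: eq_big => [t|t _].
  by rewrite (permPl (perm_eq_swap t i j)).
have -> : \prod_r c (tnth (swap t i j) r) (x (tperm i j r)) =
    \prod_r c (tnth t r) (x r).
  rewrite [RHS](reindex_inj (@perm_inj _ (tperm i j))) /=.
  by apply: eq_bigr => r _; rewrite tnth_mktuple.
have [->|nz] := eqVneq (\prod_r c (tnth t r) (x r)) 0; first by rewrite !mulr0.
by rewrite -!(homogeneous_prod xp nz) mulrA -tuple_sign_swap.
Qed.

(** Only the monomial [t = s] survives, and it is a rearrangement of [s'] only if the two sorted
    tuples agree. *)
Lemma wedge_basis s s' : sorted sle s -> sorted sle s' ->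
  wedge (fun i => e (tnth s i)) s' = (s == s')%:R.
Proof.
move=> ss ss'; rewrite ffunE.
have delta t : \prod_i c (tnth t i) (e (tnth s i)) = (t == s)%:R.
  have [->|ts] := eqVneq t s.
    by rewrite big1 // => i _; rewrite (gb_dual ec) eqxx.
  have [i tsi] : exists i, tnth t i != tnth s i.
    apply/existsP; rewrite -negb_forall; apply: contraNN ts => /forallP ts.
    by apply/eqP/eq_from_tnth => i; apply/eqP.
  by rewrite (bigD1 i) //= (gb_dual ec) (negPf tsi) mul0r.
under eq_bigr => t _ do rewrite delta.
have [<-|nss'] := eqVneq s s'.
  rewrite (bigD1 s) //= eqxx mulr1 tuple_sign_sorted // big1 ?addr0 // => t.
  by case/andP=> _ /negPf ->; rewrite mulr0.
rewrite big1 // => t ts'; have [ts|_] := eqVneq t s; last by rewrite mulr0.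
case/eqP: nss'; apply: val_inj; apply: (perm_superle_sorted ss ss').
by rewrite -ts.
Qed.

(* The central extension V + W of V (with zero bracket) by W, where W is the
   space of the values of wedge. *)
Definition ext_hpart (a : bool) : set (V * {ffun n.-tuple 'I_D -> K^o}) :=
  fun v : V * {ffun n.-tuple 'I_D -> K^o} =>
    hpart V a v.1 /\ forall s, v.2 s != 0 -> seq_parity s = a.

Lemma ext_hpart_subspace a : subspace (ext_hpart a).
Proof.
split=> [|b u v [u1 u2] [v1 v2]].
  by split=> [|s] /=; [exact: (hpart_subspace _ _).1 | rewrite ffunE eqxx].
split=> [|s]; first exact: (hpart_subspace V a).2.
apply: contra_neq_eq => sa; rewrite !ffunE /=.
have zero (w : {ffun n.-tuple 'I_D -> K^o}) :
    (forall s, w s != 0 -> seq_parity s = a) -> w s = 0.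
  by move=> ws; apply/eqP; apply: contraNT sa => /ws ->.
by rewrite (zero _ u2) (zero _ v2) scaler0 addr0.
Qed.

Lemma ext_hpart_sum v : exists v0 v1,
  [/\ ext_hpart false v0, ext_hpart true v1 & v = v0 + v1].
Proof.
case: v => v w; have [v0 [v1 [h0 h1 ->]]] := hpart_sum v.
pose part a : {ffun n.-tuple 'I_D -> K^o} :=
  [ffun s : n.-tuple 'I_D => if seq_parity s == a then w s else 0].
have partP a s : part a s != 0 -> seq_parity s = a.
  by rewrite ffunE; case: (seq_parity s =P a) => // _; rewrite eqxx.
exists (v0, part false), (v1, part true); split.
- by split=> // s; apply: partP.
- by split=> // s; apply: partP.
congr pair; apply/ffunP => s; rewrite !ffunE.
by case: (seq_parity s); rewrite ?addr0 ?add0r.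
Qed.

Lemma ext_hpart_cap : (ext_hpart false `&` ext_hpart true = [set 0])%classic.
Proof.
apply/seteqP; split=> [[v w] [[v0 w0] [v1 w1]]|_ ->]; last first.
  by split; exact: (ext_hpart_subspace _).1.
congr pair; first exact: (hpart_zero v0 v1).
apply/ffunP => s; rewrite ffunE; apply/eqP/negPn/negP => ws.
by have := w0 s ws; rewrite (w1 s ws).
Qed.

Definition ext_superspace :=
  Superspace ext_hpart_subspace ext_hpart_sum ext_hpart_cap.

Definition ext_bracket (x : 'I_n -> ext_superspace) : ext_superspace :=
  (0, wedge (fun i => (x i).1)).

Lemma upd_fst (x : 'I_n -> ext_superspace) i u :
  (fun r => (upd x i u r).1) = upd (fun r => (x r).1) i u.1.
Proof. by apply: funext => r; rewrite /upd; case: eqP. Qed.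

Lemma ext_bracket_eq0 (x : 'I_n -> ext_superspace) i :
  (x i).1 = 0 -> ext_bracket x = 0.
Proof. by move=> xi0; rewrite /ext_bracket (wedge_eq0 (i := i)). Qed.

Lemma ext_linear (x : 'I_n -> ext_superspace) i (a : K) (u v : ext_superspace) :
  ext_bracket (upd x i (a *: u + v)) =
  a *: ext_bracket (upd x i u) + ext_bracket (upd x i v).
Proof.
rewrite /ext_bracket !upd_fst /= wedge_multilinear.
by congr pair; rewrite /= scaler0 addr0.
Qed.

Lemma ext_bracket_hpart (x : 'I_n -> ext_superspace) (p : 'I_n -> bool) :
  (forall i, hpart ext_superspace (p i) (x i)) ->
  hpart ext_superspace (parity xpredT p) (ext_bracket x).
Proof.
move=> xp; split=> [|s]; first exact: (hpart_subspace _ _).1.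
by apply: wedge_parity => i; case: (xp i).
Qed.

Lemma ext_bracket_skew (x : 'I_n -> ext_superspace) (p : 'I_n -> bool)
  (i j : 'I_n) : (forall r, hpart ext_superspace (p r) (x r)) ->
  j = i.+1 :> nat ->
  ext_bracket x =
  - ((-1) ^+ (p i && p j) *: ext_bracket (fun r => x (tperm i j r))).
Proof.
move=> xp ji; rewrite /ext_bracket (@wedge_skew _ p i j) // => [|r].
  by congr pair; rewrite /= ?scaler0 ?oppr0 // /kappa scaleNr.
by case: (xp r).
Qed.

(** A bracket has first component 0, and brackets depend on first components only; so every iterated
    bracket is 0. *)
Lemma ext_bracket_filippov (l : 'I_n) (x y : 'I_n -> ext_superspace)
  (p q : 'I_n -> bool) :
  l.+1 = n ->
  (forall i, i != l -> hpart ext_superspace (p i) (x i)) ->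
  (forall i, hpart ext_superspace (q i) (y i)) ->
  ext_bracket (upd x l (ext_bracket y)) =
  \sum_(i < n)
    (-1) ^+ (parity [pred j : 'I_n | (j < i)%N] q && parity (predC1 l) p) *:
    ext_bracket (upd y i (ext_bracket (upd x l (y i)))).
Proof.
move=> _ _ _; rewrite (ext_bracket_eq0 (i := l)) ?/upd ?eqxx //.
rewrite big1 // => i _; rewrite (ext_bracket_eq0 (i := i)) ?scaler0 //.
by rewrite /upd eqxx.
Qed.

Definition ext_nls := NLieSuperalgebra ext_linear ext_bracket_hpart
  ext_bracket_skew ext_bracket_filippov.

End Wedge.

(** Bundles a map given pointwise, as the uniqueness clause of [free_nls] speaks of bundled linear
    maps. *)
Lemma exists_linear (K : fieldType) (U V : lmodType K) (f : U -> V) :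
  linear f -> exists g : {linear U -> V}, g =1 f.
Proof.
move=> fl.
pose mix := GRing.isLinear.Build K U V _ f fl.
pose g : {linear U -> V} := HB.pack f mix.
by exists g.
Qed.

(** * Brackets modulo [[R, F, ..., F]] *)

Section Brackets.
Variables (n : nat) (K : fieldType) (F L : nLieSuperalgebra n K).
Variable phi : {linear F -> L}.
Hypothesis hphi : nls_hom phi.
Hypothesis n_gt0 : (0 < n)%N.

Local Notation J := (bracket_ideal (kernel phi)).

Lemma bracket_multilinear : multilinear (bracket F).
Proof. by move=> x i a u v; apply: bracket_linear. Qed.

Lemma bracket_slot0 (G : nLieSuperalgebra n K) (x : 'I_n -> G) i :
  x i = 0 -> bracket G x = 0.
Proof.
move=> xi0; rewrite -(upd_id x i) xi0.
by have := bracket_linear x i (-1) 0 0; rewrite scaler0 addr0 scaleN1r addNr.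
Qed.

Lemma bracket_swap (G : nLieSuperalgebra n K) (x : 'I_n -> G)
    (p : 'I_n -> bool) (i j : 'I_n) :
  (forall r, hpart G (p r) (x r)) -> j = i.+1 :> nat ->
  bracket G x = kappa K (p i) (p j) *: bracket G (fun r => x (tperm i j r)).
Proof. by move=> xp ji; rewrite /kappa scaleNr; apply: bracket_skew. Qed.

(** Adjacent swaps move the entry in the kernel down to slot 0, the slot that [bracket_ideal]
    constrains. *)
Lemma bracket_ideal_homogeneous (x : 'I_n -> F) (p : 'I_n -> bool) i :
  (forall r, hpart F (p r) (x r)) -> phi (x i) = 0 -> J (bracket F x).
Proof.
move: {2}(val i) (erefl (val i)) => k; elim: k => [|k IHk] in i x p *.
  move=> i0 _ xi0; apply: sub_span; exists x => // j j0.
  by rewrite (_ : j = i) //; apply: val_inj; rewrite /= j0 i0.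
move=> ik xp xi0; have lt_kn : (k < n)%N by apply: ltnW; rewrite -ik ltn_ord.
pose j := Ordinal lt_kn; rewrite (bracket_swap (i := j) (j := i) xp ik).
apply: (subspaceZ _ (subspace_span _)).
apply: (IHk j _ (fun r => p (tperm j i r))) => //.
by rewrite tpermL.
Qed.

(** Skew-symmetry is available for homogeneous entries only; by multilinearity these suffice, slot
    [i] being spanned by homogeneous kernel elements. *)
Lemma bracket_idealP (x : 'I_n -> F) i : phi (x i) = 0 -> J (bracket F x).
Proof.
move=> xi0.
pose A (r : 'I_n) := [set v : F | (r = i -> phi v = 0) /\
  exists a, hpart F a v]%classic.
apply: (@multilinear_span _ _ _ _ (bracket F) J A bracket_multilinear).
- exact: subspace_span.
- move=> y Ay; have /choice [p yp] := fun r => (Ay r).2.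
  by apply: (bracket_ideal_homogeneous yp (i := i)); apply: (Ay i).1.
move=> r; have [->|ri] := eqVneq r i.
  have := kernel_homogeneous hphi.1 xi0.
  by apply: span_min; [exact: subspace_span|move=> v [? ?]; apply: sub_span].
have [w [hw ->]] := hpart_parts (x r).
apply: (subspaceD (subspace_span _)); apply: sub_span; split.
- by move=> re; rewrite re eqxx in ri.
- by exists false.
- by move=> re; rewrite re eqxx in ri.
by exists true.
Qed.

Lemma bracket_ideal_vanish (G : nLieSuperalgebra n K) (psi : {linear F -> G}) :
  (forall x i, phi (x i) = 0 -> psi (bracket F x) = 0) ->
  forall u, J u -> psi u = 0.
Proof.
move=> psi0; apply: (@span_min _ _ _ [set u | psi u = 0]%classic).
  exact: (subspace_preimage psi (subspace0 _)).
(* Slot 0 exists because [n] is positive. *)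
by move=> _ [x xJ <-]; apply: (psi0 _ (Ordinal n_gt0)); apply: xJ.
Qed.

Lemma bracket_ideal_sub u : J u -> phi u = 0.
Proof.
apply: bracket_ideal_vanish => x i xi0.
by rewrite hphi.2 (bracket_slot0 (i := i)).
Qed.

Lemma pi_eq0 u : lquot_pi J u = 0 <-> J u.
Proof.
by rewrite -(linear0 (lquot_pi J)) lquot_piE subr0 span_id //; apply: subspace_span.
Qed.

Variables (D : nat) (par : pred 'I_D) (e : 'I_D -> L) (c : 'I_D -> L -> K).
Hypothesis ec : graded_basis par e c.
Variable g : 'I_D -> F.
Hypothesis ghpart : forall j, hpart F (par j) (g j).
Hypothesis phig : forall j, phi (g j) = e j.

Definition lift_bracket (t : n.-tuple 'I_D) : lquot J :=
  lquot_pi J (bracket F (fun i => g (tnth t i))).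

Local Notation S := [set t : n.-tuple 'I_D | sorted (superle par) t]%SET.

Definition sorted_brackets (a : 'I_#|S|) : lquot J := lift_bracket (enum_val a).

Lemma lift_bracket_swap (t : n.-tuple 'I_D) (i j : 'I_n) : j = i.+1 :> nat ->
  lift_bracket t =
  kappa K (par (tnth t i)) (par (tnth t j)) *: lift_bracket (swap t i j).
Proof.
move=> ji; rewrite /lift_bracket -linearZ /=; congr (lquot_pi J _).
rewrite (@bracket_swap _ _ (fun r => par (tnth t r)) i j) //.
by congr (_ *: bracket F _); apply: funext => r; rewrite tnth_mktuple.
Qed.

(** Bubble sort: a swap only rescales the class, and a repeated even index makes the class equal to
    its own negative, hence zero as 2 is invertible. *)
Lemma lift_bracket_span (t : n.-tuple 'I_D) :
  [pchar K] =i pred0 -> span (range sorted_brackets) (lift_bracket t).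
Proof.
move=> charK; move: t; apply: (bubble_ind (par := par)) => [t st|t i j ji IH|t i j ji tij nt].
- apply: sub_span; have tS : t \in S.
    by rewrite inE.
  by exists (enum_rank_in tS t) => //; rewrite /sorted_brackets enum_rankK_in.
- by rewrite (lift_bracket_swap _ ji); apply: (subspaceZ _ (subspace_span _)).
suff -> : lift_bracket t = 0 by exact: (subspace_span _).1.
have := lift_bracket_swap t ji; rewrite (_ : swap t i j = t); last first.
  by apply: eq_from_tnth => r; rewrite tnth_mktuple; case: tpermP => // ->.
rewrite /kappa (negPf nt) /= expr0 scaleN1r => /eqP.
rewrite -addr_eq0 -mulr2n -scaler_nat scaler_eq0 => /orP [two|/eqP //].
by have := charK 2%N; rewrite !inE /= two.
Qed.

(** Each slot is spanned by the kernel and the lifts [g j]; an entry in the kernel makes the class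
    zero. *)
Lemma pi_bracket_span (x : 'I_n -> F) : [pchar K] =i pred0 ->
  span (range sorted_brackets) (lquot_pi J (bracket F x)).
Proof.
move=> charK; pose A (r : 'I_n) := [set v | phi v = 0 \/ range g v]%classic.
apply: (@multilinear_span _ _ _ _ (bracket F)
  (lquot_pi J @^-1` span (range sorted_brackets))%classic A bracket_multilinear).
- by apply: subspace_preimage; exact: subspace_span.
- move=> y Ay /=; have [[i yi0]|ny0] := EM (exists i, phi (y i) = 0).
    have -> : lquot_pi J (bracket F y) = 0.
      by apply/pi_eq0; apply: (bracket_idealP yi0).
    exact: (subspace_span _).1.
  have /choice [s sE] : forall i, exists j, g j = y i.
    move=> i; have [yi0|[j _ <-]] := Ay i; last by exists j.
    by case: ny0; exists i.
  rewrite (_ : y = fun i => g (tnth (mktuple s) i)).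
    exact: lift_bracket_span.
  by apply: funext => i; rewrite tnth_mktuple sE.
(* [v] is the combination of lifts with the same image in [L] as [x r]. *)
move=> r; pose v := \sum_j c j (phi (x r)) *: g j.
rewrite -(subrK v (x r)); apply: (subspaceD (subspace_span _)).
  apply: sub_span; left; rewrite linearB linear_sum /=.
  under eq_bigr => j _ do rewrite linearZ phig.
  by rewrite -(gb_expand ec) subrr.
apply: (subspace_sum (subspace_span _)) => j.
by apply: (subspaceZ _ (subspace_span _)); apply: sub_span; right; exists j.
Qed.

Lemma pi_derived_span u : [pchar K] =i pred0 ->
  derived F u -> span (range sorted_brackets) (lquot_pi J u).
Proof.
move=> charK; move: u.
apply: (@span_min _ _ _ (lquot_pi J @^-1` span (range sorted_brackets))%classic).
  by apply: subspace_preimage; exact: subspace_span.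
by move=> _ [x _ <-]; apply: pi_bracket_span.
Qed.

(* Freeness lifts phi to the central extension of L (made abelian) by the
   super exterior power; the lift vanishes on [R, F, ..., F]. *)
Lemma sorted_brackets_free :
  free_nls F -> abelian_nls L -> free_family sorted_brackets.
Proof.
move=> [X [deg [iota [hiota univ]]]] abL b sum0.
pose E := ext_nls ec n.
(* The second component 0 is homogeneous of every degree, so these images of the generators have the
   required degrees. *)
have [|psi [hpsi psi_iota _]] := univ E (fun t => (phi (iota t), 0)).
  by move=> t; split=> [|s] /=; [apply: hphi.1 | rewrite ffunE eqxx].
(* Since [L] is abelian, the first component of [psi] is a homomorphism to [L]; it agrees with [phi]
   on generators, hence everywhere. *)
have psi1 u : (psi u).1 = phi u.
  have [|chi [_ _ chi_uniq]] := univ L (fun t => phi (iota t)).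
    by move=> t; apply: hphi.1.
  have [psi' psi'E] : exists psi' : {linear F -> L}, forall u, psi' u = (psi u).1.
    by apply: exists_linear => a v w; rewrite linearP.
  have bracket0 x : bracket L x = 0.
    have : derived L (bracket L x) by apply: sub_span; exists x.
    by rewrite abL.
  rewrite -psi'E (chi_uniq psi') ?(chi_uniq phi) // => [|t].
    split=> [a v hv|x]; first by rewrite psi'E; case: (hpsi.1 a v hv).
    by rewrite psi'E hpsi.2 bracket0.
  by rewrite psi'E psi_iota.
have psiJ : forall u, J u -> psi u = 0.
  apply: bracket_ideal_vanish => x i xi0.
  by rewrite hpsi.2; apply: (ext_bracket_eq0 ec (i := i)); rewrite psi1.
move=> a; have sortedS (i : 'I_#|S|) : sorted (superle par) (enum_val i).
  by have := enum_valP i; rewrite inE.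
(* The coordinate at the [a]-th sorted tuple: applied to the image of the relation under [psi], it
   extracts [b a]. *)
have [coord coordE] : exists f : {linear E -> K^o},
    forall v, f v = v.2 (enum_val a).
  by apply: exists_linear => b' v w; rewrite !ffunE.
have coord_psi i : coord (psi (bracket F (fun r => g (tnth (enum_val i) r)))) =
    (i == a)%:R.
  rewrite coordE hpsi.2 /= (_ : (fun r => _) = fun r => e (tnth (enum_val i) r)).
    by rewrite (wedge_basis ec) // (inj_eq enum_val_inj).
  by apply: funext => r; rewrite psi1 phig.
have : J (\sum_i b i *: bracket F (fun r => g (tnth (enum_val i) r))).
  apply/pi_eq0; rewrite linear_sum -[RHS]sum0.
  by apply: eq_bigr => i _; rewrite linearZ.
move/psiJ/(congr1 coord); rewrite linear0 !linear_sum (bigD1 a) //= big1.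
  by rewrite addr0 !linearZ coord_psi eqxx /= => <-; rewrite -[RHS]/(_ * _) mulr1.
by move=> i /negPf ia; rewrite !linearZ /= coord_psi ia scaler0.
Qed.

End Brackets.

Theorem theorem4p3 (K : fieldType) (charK : [pchar K] =i pred0)
  (n : nat) (n_ge2 : (2 <= n)%N)
  (m k : nat) (L : nLieSuperalgebra n K)
  (dimL0 : has_dim (hpart L false) m) (dimL1 : has_dim (hpart L true) k)
  (F : nLieSuperalgebra n K) (phi : {linear F -> L})
  (presL : free_presentation phi) :
  exists d : nat,
    [/\ has_dim (schur_multiplier phi) d,
        (d <= \sum_(0 <= i < n.+1) 'C(m, i) * calL (n - i) k)%N &
        d = (\sum_(0 <= i < n.+1) 'C(m, i) * calL (n - i) k)%N
          <-> abelian_nls L].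
Proof.
have [freeF hphi phi_onto] := presL.
have n_gt0 : (0 < n)%N := ltnW n_ge2.
have [e [c ec]] := exists_graded_basis dimL0 dimL1.
have /choice [g gP] (j : 'I_(m + k)) : exists v, hpart F (m <= j)%N v /\ phi v = e j.
  have [v hv <-] := even_linear_lift hphi.1 phi_onto (gb_hpart ec j).
  by exists v.
have ghpart j := (gP j).1; have phig j := (gP j).2.
rewrite -(card_superle_sorted m k n).
set M := schur_multiplier phi.
pose w : 'I__ -> _ := sorted_brackets phi (par := @odd_index m k) g.
have bracketw x : span (range w) (lquot_pi _ (bracket F x)).
  exact: (pi_bracket_span hphi ec ghpart phig x charK).
have subM : subspace M.
  apply: subspace_image; apply: subspace_capP; last exact: subspace_span.
  exact: (subspace_preimage phi (subspace0 _)).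
have Mw : (M `<=` span (range w))%classic.
  by move=> _ [u [_ uF2] <-]; apply: (pi_derived_span hphi ec).
have [d dimM le_d] := subspace_has_dim subM Mw.
exists d; split=> //; split=> [dN|abL].
  apply: contrapT => nab.
  have [x bx0] : exists x, bracket L x <> 0.
    apply: contrapT => /forallNP b0; apply: nab; apply/seteqP; split=> [|u ->].
      apply: span_min; first exact: subspace0.
      by move=> _ [x _ <-]; apply: contrapT; apply: b0.
    exact: (subspace_span _).1.
  have /choice [y yx] i : exists v, phi v = x i.
    by have [v _ <-] : range phi (x i) by [rewrite phi_onto]; exists v.
  suff : (d < d)%N by rewrite ltnn.
  rewrite {2}dN; apply: (has_dim_lt Mw dimM (bracketw y)).
  (* If this class lay in the multiplier, [bracket F y] would differ from an element of the kernel
     by one of [[R, F, ..., F]], itself in the kernel; then [bracket L x] would be 0. *)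
  move=> [u [/= u0 _] /lquot_piE]; rewrite span_id; last exact: subspace_span.
  move/(bracket_ideal_sub hphi n_gt0); rewrite linearB u0 sub0r hphi.2.
  by move/eqP; rewrite oppr_eq0 => /eqP; under eq_fun do rewrite yx.
apply/eqP; rewrite eqn_leq le_d; apply: (has_dim_ge dimM).
  exact: (sorted_brackets_free hphi n_gt0 ec phig freeF abL).
(* All brackets of [F] map to 0 in the abelian [L], so the sorted brackets lie in the multiplier. *)
move=> i; exists (bracket F (fun r => g (tnth (enum_val i) r))) => //.
split; last by apply: sub_span; exists (fun r => g (tnth (enum_val i) r)).
rewrite /kernel /= hphi.2 -[RHS]/(0 : L).
have : derived L (bracket L (fun r => phi (g (tnth (enum_val i) r)))).
  by apply: sub_span; exists (fun r => phi (g (tnth (enum_val i) r))).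
by rewrite abL.
Qed.
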